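(* Let $\theta\in C_n$ be a cyclic permutation of $\{1,\dots,n\}$, and let $\eta=\theta^*\circ\rho_{i_1}\circ\rho_{i_2}\circ\cdots\circ\rho_{i_m}\in S_{2n}$ with $1\le i_1<i_2<\cdots<i_m\le n$. Let $M(\theta)=[a_{i,j}]_{1\le i,j\le n-1}$ and $M(\eta)=[b_{i,j}]_{1\le i,j\le 2n-1}$ be the adjacency matrices of $G(\theta)$ and $G(\eta)$. Then the induced subgraph $G(\eta)|_{\mathcal W_1}$ is isomorphic to $G(\theta)$ via the map $\varphi(v_i)=w_{2i}$, $1\le i\le n-1$; namely, $$b_{2i,2j}=a_{i,j}\qquad\text{for all }1\le i,j\le n-1.$$
   Context: $S_n$ is the group of permutations of $\{1,\dots,n\}$, and $C_n\subset S_n$ is the set of cyclic permutations of length $n$, i.e. bijections $\theta$ of $\{1,\dots,n\}$ with $\theta^k(1)\ne 1$ for $1\le k<n$. For $\theta\in C_n$, the permutation $\theta^*\in S_{2n}$ is defined by $\theta^*(2k)=2\theta(k)$ and $\theta^*(2k-1)=2\theta(k)-1$ for $k\in\{1,\dots,n\}$. For $s\in\{1,\dots,n\}$, $\rho_s$ is the transposition exchanging $2s-1$ and $2s$. Composition is of functions, right factor applied first. The number $m$ of transpositions may be odd or even ($m=0$, giving $\eta=\theta^*$, is allowed). For a permutation $\tau\in S_N$, $L_\tau:[1,N]\to[1,N]$ is the continuous map that agrees with $\tau$ on $\{1,\dots,N\}$ and is linear (affine) on each interval $I_i=[i,i+1]$, $1\le i\le N-1$. The digraph $G(\tau)$ has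 $N-1$ vertices indexed by $1,\dots,N-1$, with a directed edge from vertex $i$ to vertex $j$ (loops allowed) exactly when $I_j\subset L_\tau(I_i)$. The adjacency matrix of $G(\tau)$ is the $(N-1)\times(N-1)$ matrix whose $(i,j)$ entry is $1$ if $I_j\subset L_\tau(I_i)$ and $0$ otherwise. Denote the vertices of $G(\theta)$ by $v_1,\dots,v_{n-1}$ and those of $G(\eta)$ by $w_1,\dots,w_{2n-1}$. Put $\mathcal W_1=\{w_2,w_4,\dots,w_{2n-2}\}$; $G(\eta)|_{\mathcal W_1}$ is the subgraph of $G(\eta)$ induced on $\mathcal W_1$ (all edges of $G(\eta)$ between vertices of $\mathcal W_1$). *)

(* Defs.v *)
(* A permutation of {1, ..., N} is an element of 'S_N; the ordinal i : 'I_N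
   stands for the point i.+1.  Likewise i : 'I_N.-1 stands for the vertex
   i.+1 of the digraph of a permutation of {1, ..., N}. *)
From HB Require Import structures.
From mathcomp Require Import all_boot all_order all_algebra all_fingroup.
From mathcomp Require Import all_classical all_reals all_analysis.
From mathcomp Require Import ring.
Set Implicit Arguments.
Unset Strict Implicit.
Unset Printing Implicit Defensive.
Import Order.TTheory GRing.Theory Num.Theory numFieldNormedType.Exports.
Local Open Scope classical_set_scope.
Local Open Scope ring_scope.

(* The ordinal x with value 0 is the point 1. *)
Definition is_cyclic n (theta : 'S_n) : Prop :=
  forall (x : 'I_n) (k : nat),
    val x = 0%N -> (0 < k < n)%N -> iter k theta x != x.

Section Doubling.
Variable n : nat.

Lemma pt_odd_subproof (k : 'I_n) : (k.*2 < n.*2)%N.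
Proof. by rewrite ltn_double. Qed.

Lemma pt_even_subproof (k : 'I_n) : (k.*2.+1 < n.*2)%N.
Proof. by rewrite ltn_Sdouble. Qed.

(* If k stands for the point K, these stand for 2K - 1 and 2K. *)
Definition pt_odd (k : 'I_n) : 'I_n.*2 := Ordinal (pt_odd_subproof k).
Definition pt_even (k : 'I_n) : 'I_n.*2 := Ordinal (pt_even_subproof k).

Lemma pt_half_subproof (x : 'I_n.*2) : (x./2 < n)%N.
Proof. by rewrite ltn_half_double. Qed.

Definition pt_half (x : 'I_n.*2) : 'I_n := Ordinal (pt_half_subproof x).

Lemma pt_half_odd k : pt_half (pt_odd k) = k.
Proof. by apply: val_inj => /=; rewrite doubleK. Qed.

Lemma pt_half_even k : pt_half (pt_even k) = k.
Proof. by apply: val_inj => /=; rewrite uphalf_double. Qed.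

Lemma pt_halfK (x : 'I_n.*2) :
  (if odd x then pt_even (pt_half x) else pt_odd (pt_half x)) = x.
Proof.
by apply: val_inj; rewrite -[RHS]odd_double_half; case: (odd x).
Qed.

Definition star_fun (theta : 'S_n) (x : 'I_n.*2) : 'I_n.*2 :=
  if odd x then pt_even (theta (pt_half x)) else pt_odd (theta (pt_half x)).

Lemma star_fun_even theta k :
  star_fun theta (pt_even k) = pt_even (theta k).
Proof. by rewrite /star_fun /= odd_double /= pt_half_even. Qed.

Lemma star_fun_odd theta k :
  star_fun theta (pt_odd k) = pt_odd (theta k).
Proof. by rewrite /star_fun /= odd_double pt_half_odd. Qed.

Lemma star_fun_inj theta : injective (star_fun theta).
Proof.
apply: (can_inj (g := star_fun theta^-1)) => x.
rewrite -[x in RHS]pt_halfK {2}/star_fun.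
by case: (odd x); rewrite ?star_fun_even ?star_fun_odd permK.
Qed.

Definition star (theta : 'S_n) : 'S_n.*2 := perm (@star_fun_inj theta).

Lemma star_even theta k : star theta (pt_even k) = pt_even (theta k).
Proof. by rewrite permE star_fun_even. Qed.

Lemma star_odd theta k : star theta (pt_odd k) = pt_odd (theta k).
Proof. by rewrite permE star_fun_odd. Qed.

Definition rho (s : 'I_n) : 'S_n.*2 := tperm (pt_odd s) (pt_even s).

End Doubling.

(* The group law of 'S_N applies the left factor first, hence the swap. *)
Definition perm_comp N (s t : 'S_N) : 'S_N := (t * s)%g.

Lemma perm_compE N (s t : 'S_N) x : perm_comp s t x = s (t x).
Proof. by rewrite permM. Qed.

Section ConnectTheDots.
Variables (R : realType) (N : nat) (tau : 'S_N).

(* tau as a map on the points 1, ..., N (and 0 outside this range). *)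
Definition at_point (k : nat) : nat :=
  if [pick i : 'I_N | i.+1 == k] is Some i then (tau i).+1 else 0.

Lemma at_pointE (i : 'I_N) : at_point i.+1 = (tau i).+1.
Proof.
rewrite /at_point; case: pickP => [j|/(_ i)]; last by rewrite eqxx.
by rewrite eqSS => /eqP/val_inj ->.
Qed.

(* Only the values on [1, N] are meaningful; see Lmap_connects and
   connects_unique. *)
Definition Lmap (x : R) : R :=
  let k := Num.truncn x in
  (at_point k)%:R + (x - k%:R) * ((at_point k.+1)%:R - (at_point k)%:R).

Definition I_ (i : 'I_N.-1) : set R := `[i.+1%:R, i.+2%:R]%classic.

Definition connects (L : R -> R) : Prop :=
  [/\ {within `[1, N%:R]%classic, continuous L},
      forall i : 'I_N, L i.+1%:R = (tau i).+1%:R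
    & forall i : 'I_N.-1, exists a b : R,
        forall x, I_ i x -> L x = a * x + b].

Lemma Lmap_point k : Lmap k%:R = (at_point k)%:R.
Proof. by rewrite /Lmap natrK subrr mul0r addr0. Qed.

Lemma Lmap_affine k (x : R) : k%:R <= x <= k.+1%:R ->
  Lmap x = (at_point k)%:R
           + (x - k%:R) * ((at_point k.+1)%:R - (at_point k)%:R).
Proof.
case/andP=> kx; rewrite le_eqVlt => /orP[/eqP ->|xk].
  by rewrite Lmap_point -natr1 addrAC subrr add0r mul1r addrC subrK.
by rewrite /Lmap (@truncn_def _ x k) // kx.
Qed.

Lemma Lmap_continuous m :
  {within `[1, m.+1%:R]%classic, continuous Lmap}.
Proof.
elim: m => [|m IHm].
  rewrite set_itv1; exact: continuous_subspace1.
have -> : `[(1 : R), m.+2%:R]%classic =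
          (`[(1 : R), m.+1%:R] `|` `[(m.+1%:R : R), m.+2%:R])%classic.
  apply/seteqP; split=> x /=; rewrite !in_itv /=.
    case/andP=> x1 xm; case: (leP x m.+1%:R) => h; [left|right].
      by rewrite x1.
    by rewrite (ltW h).
  case=> /andP[h1 h2]; apply/andP; split=> //.
    by apply: le_trans h2 _; rewrite ler_nat.
  by apply: le_trans h1; rewrite ler1n.
apply: withinU_continuous => //; try exact: interval_closed.
set g : R -> R := fun x => (at_point m.+1)%:R
  + (x - m.+1%:R) * ((at_point m.+2)%:R - (at_point m.+1)%:R).
apply: (@subspace_eq_continuous _ _ _ g).
  by move=> x; rewrite inE /= in_itv /= => /Lmap_affine.
apply: continuous_subspaceT => x.
apply: cvgD; first exact: cvg_cst.
apply: cvgM; last exact: cvg_cst.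
by apply: cvgB; [exact: cvg_id|exact: cvg_cst].
Qed.

Lemma Lmap_connects : connects Lmap.
Proof.
split.
- have [->|] := posnP N; last by move/prednK <-; exact: Lmap_continuous.
  rewrite set_itv_ge ?bnd_simp ?ler10 //; exact: continuous_subspace0.
- by move=> i; rewrite Lmap_point at_pointE.
- move=> i; set d : R := (at_point i.+2)%:R - (at_point i.+1)%:R.
  exists d, ((at_point i.+1)%:R - i.+1%:R * d) => x.
  rewrite /I_ /= in_itv /= => /Lmap_affine ->; rewrite -/d.
  by rewrite mulrBl mulrC addrCA.
Qed.

Lemma connects_unique (L : R -> R) : connects L ->
  {in `[1, N%:R], L =1 Lmap}.
Proof.
case=> _ Lpt Laff x; rewrite in_itv /= => /andP[x1 xN].
have x0 : 0 <= x by apply: le_trans x1.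
set k := Num.truncn x.
have /andP[kx xk] := truncn_itv x0.
have k0 : (0 < k)%N by rewrite truncn_gt0.
have : (k <= N)%N by rewrite -(ler_nat R) (le_trans kx).
rewrite leq_eqVlt => /orP[/eqP kN|kN].
  have -> : x = k%:R by apply/eqP; rewrite eq_le kx {1}kN xN.
  have kN1 : (k.-1 < N)%N by rewrite prednK // kN.
  have := Lpt (Ordinal kN1); have := at_pointE (Ordinal kN1).
  by rewrite /= prednK // Lmap_point => -> ->.
have kN1 : (k.-1 < N)%N by rewrite prednK // ltnW.
have kN2 : (k.-1 < N.-1)%N by rewrite -ltnS !prednK // (leq_ltn_trans _ kN).
have [a [b Lab]] := Laff (Ordinal kN2).
have inI y : k%:R <= y <= k.+1%:R -> L y = a * y + b.
  by move=> ky; apply: Lab; rewrite /I_ /= prednK // in_itv.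
have e1 : L k%:R = (at_point k)%:R.
  have := Lpt (Ordinal kN1); have := at_pointE (Ordinal kN1).
  by rewrite /= prednK // => -> ->.
have e2 : L k.+1%:R = (at_point k.+1)%:R.
  by have := Lpt (Ordinal kN); have := at_pointE (Ordinal kN) => /= -> ->.
have kxk : k%:R <= x <= k.+1%:R by rewrite kx ltW.
rewrite (Lmap_affine kxk) -e1 -e2 !inI ?lexx ?ler_nat ?leqnSn //.
by rewrite -(natr1 k); ring.
Qed.

(* Edge from i to j iff I_j is contained in L_tau(I_i). *)
Definition G : rel 'I_N.-1 :=
  [rel i j | `[< (I_ j `<=` [set Lmap x | x in I_ i])%classic >]].

End ConnectTheDots.

Definition adjacency N (e : rel 'I_N) : 'M[nat]_N :=
  \matrix_(i, j) (e i j : nat).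

Definition digraph_iso_onto (V V' : finType) (e : rel V) (e' : rel V')
    (W : {set V'}) (phi : V -> V') : Prop :=
  [/\ injective phi, [set phi v | v in [set: V]]%SET = W
    & forall u v, e' (phi u) (phi v) = e u v].

(* The vertices w_2, w_4, ..., w_(2n-2): those with even label w.+1. *)
Definition W1 n : {set 'I_n.*2.-1} := [set w : 'I_n.*2.-1 | ~~ odd w.+1]%SET.

Lemma vtx_even_subproof n (i : 'I_n.-1) : (i.*2.+1 < n.*2.-1)%N.
Proof. by case: n i => [|n] [i i_lt] //=; rewrite ltnS ltn_double. Qed.

(* phi(v_I) = w_(2I); with I = i.+1, the index is 2I - 1 = i.*2.+1. *)
Definition vtx_even n (i : 'I_n.-1) : 'I_n.*2.-1 :=
  Ordinal (vtx_even_subproof i).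

(* Main.v *)
(* An affine image of a segment is the segment spanned by the images of its
   endpoints, so i -> j is an edge of G(tau) iff one of tau(i), tau(i+1) is at
   most j and the other is at least j+1.  The permutation eta maps the pair
   {2k-1, 2k} onto {2 theta(k) - 1, 2 theta(k)}, and [2j, 2j+1] is the gap
   between the j-th pair and the next one; hence [2j, 2j+1] separates eta(2i)
   from eta(2i+1) iff [j, j+1] separates theta(i) from theta(i+1). *)
Require Import Defs.
From mathcomp Require Import all_boot all_order all_algebra all_fingroup.
From mathcomp Require Import all_classical all_reals all_analysis.
From mathcomp Require Import zify ring lra.
Set Implicit Arguments.
Unset Strict Implicit.
Unset Printing Implicit Defensive.
Import Order.TTheory GRing.Theory Num.Theory numFieldNormedType.Exports.
Local Open Scope ring_scope.

(** The values [j] and [j.+1] are attained as convex combinations of [A] and [B], so both lie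
    between them. Conversely, the affine map can be inverted. *)
Lemma affine_covers (R : realFieldType) (A B j k : nat) :
  (forall y : R, j%:R <= y <= j.+1%:R ->
    exists2 x : R, k%:R <= x <= k.+1%:R & A%:R + (x - k%:R) * (B%:R - A%:R) = y)
  <-> (minn A B <= j < maxn A B)%N.
Proof.
have kS : k.+1%:R = k%:R + 1 :> R by rewrite natr1.
have jS : j.+1%:R = j%:R + 1 :> R by rewrite natr1.
split=> [cover | /andP[minj jmax] y /andP[jy yj]].
  have [|x1 /andP[kx1 x1k] e1] := cover j%:R.
    by rewrite lexx ler_nat leqnSn.
  have [|x2 /andP[kx2 x2k] e2] := cover j.+1%:R.
    by rewrite lexx ler_nat leqnSn.
  rewrite geq_min leq_max -!(ler_nat R).
  case: (lerP (A%:R : R) B%:R) => AB.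
    apply/andP; split; apply/orP; [left | right]; nra.
  apply/andP; split; apply/orP; [right | left]; nra.
have AB : (B%:R - A%:R : R) != 0.
  by rewrite subr_eq0 eqr_nat; lia.
(* The solution of the affine equation in [x]; the slope is nonzero since [minn A B < maxn A B]. *)
exists (k%:R + (y - A%:R) / (B%:R - A%:R)); last by field.
have [ltAB | leBA] := ltnP A B.
  have [leAj ltjB] : (A <= j)%N /\ (j.+1 <= B)%N by lia.
  have d0 : 0 < B%:R - A%:R :> R by rewrite subr_gt0 ltr_nat.
  move: leAj ltjB; rewrite -!(ler_nat R) => leAj ltjB.
  rewrite kS lerDl lerD2l ler_pdivrMr // divr_ge0 ?(ltW d0) //=; lra.
have [leBj ltjA] : (B <= j)%N /\ (j.+1 <= A)%N by lia.
have d0 : 0 < A%:R - B%:R :> R by rewrite subr_gt0 ltr_nat; lia.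
move: leBj ltjA; rewrite -!(ler_nat R) => leBj ltjA.
(* Here the slope is negative: the quotient becomes [(y - A) / (B - A) = (A - y) / (A - B)], with
   positive denominator. *)
rewrite -mulrNN -invrN !opprB kS lerDl lerD2l.
rewrite ler_pdivrMr // divr_ge0 ?(ltW d0) //=; lra.
Qed.

Lemma G_edgeE (R : realType) N (tau : 'S_N) (i j : 'I_N.-1) (p q : 'I_N) :
  val p = i -> val q = i.+1 ->
  G R tau i j = (minn (tau p) (tau q) <= j < maxn (tau p) (tau q))%N.
Proof.
move=> pi qi.
(* Ordinal values are one less than the points they stand for; shifting all of them gives the form
   of [affine_covers]. *)
have -> : (minn (tau p) (tau q) <= j < maxn (tau p) (tau q))%N =
    (minn (tau p).+1 (tau q).+1 <= j.+1 < maxn (tau p).+1 (tau q).+1)%N by lia.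
have Ap : at_point tau i.+1 = (tau p).+1 by rewrite -at_pointE pi.
have Aq : at_point tau i.+2 = (tau q).+1 by rewrite -at_pointE qi.
apply/asboolP/idP.
  move=> sub; apply/(affine_covers R _ _ _ i.+1) => y yj.
  have [|x /=] := sub y; first by rewrite /I_ /= in_itv.
  rewrite /I_ /= in_itv /= => xi <-.
  by exists x => //; rewrite (Lmap_affine _ xi) Ap Aq.
move=> /(affine_covers R _ _ _ i.+1) cover y.
rewrite /I_ /= in_itv /= => /cover[x xi <-].
by exists x; rewrite /= ?in_itv //= (Lmap_affine _ xi) Ap Aq.
Qed.

Lemma pt_half_rho n (s : 'I_n) x : pt_half (rho s x) = pt_half x.
Proof.
by rewrite /rho; case: tpermP => [->|->|//]; rewrite pt_half_odd pt_half_even.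
Qed.

Lemma pt_half_star n (theta : 'S_n) x :
  pt_half (star theta x) = theta (pt_half x).
Proof.
by rewrite permE /star_fun; case: (odd x); rewrite ?pt_half_even ?pt_half_odd.
Qed.

(** Each [rho i] only swaps the two points of one pair, so it preserves [pt_half], and this property
    is stable under composition. *)
Lemma pt_half_star_rho n (theta : 'S_n) (s : seq 'I_n) x :
  pt_half (perm_comp (star theta) (\big[@perm_comp n.*2/1%g]_(i <- s) rho i) x)
  = theta (pt_half x).
Proof.
rewrite perm_compE pt_half_star; congr (theta _); move: x.
apply: (big_ind (fun t : 'S_n.*2 => forall x, pt_half (t x) = pt_half x)).
- by move=> x; rewrite perm1.
- by move=> t u ht hu x; rewrite perm_compE ht hu.
- by move=> i _; exact: pt_half_rho.
Qed.

Lemma G_vtx_even (R : realType) n (theta : 'S_n) (eta : 'S_n.*2) :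
  (forall x, pt_half (eta x) = theta (pt_half x)) ->
  forall i j, G R eta (vtx_even i) (vtx_even j) = G R theta i j.
Proof.
move=> half_eta i j.
have pn : (i < n)%N by case: i => /= i; lia.
have qn : (i.+1 < n)%N by case: i {pn} => /= i; lia.
set p := Ordinal pn; set q := Ordinal qn.
rewrite (@G_edgeE R _ theta i j p q) //.
(* The segment from 2i to 2i+1 joins the last point of one pair to the first point of the next. *)
rewrite (@G_edgeE R _ eta _ _ (pt_even p) (pt_odd q)) //=.
have := congr1 val (half_eta (pt_even p)); rewrite pt_half_even /= => <-.
have := congr1 val (half_eta (pt_odd q)); rewrite pt_half_odd /= => <-.
(* For a natural number a, [a <= j.*2.+1] iff [a./2 <= j]; apply this to both values of [eta]. *)
by lia.
Qed.

Lemma vtx_even_inj n : injective (@vtx_even n).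
Proof. by move=> i j /(congr1 val) /= [] /double_inj /val_inj. Qed.

Lemma vtx_even_image n : [set vtx_even i | i in [set: 'I_n.-1]]%SET = W1 n.
Proof.
apply/setP => w; rewrite inE; apply/imsetP/idP.
  by case=> i _ ->; rewrite /= odd_double.
move=> /= w_odd.
(* The zero-based value of [w] is odd, [w = (w./2).*2.+1]. *)
have wn : (w./2 < n.-1)%N by case: w w_odd => /= w; lia.
by exists (Ordinal wn); rewrite ?inE //; apply: val_inj => /=; lia.
Qed.

Theorem lemma3p1 (R : realType) (n : nat) (hn : (0 < n)%N)
    (theta : 'S_n) (htheta : is_cyclic theta)
    (s : seq 'I_n) (hs : sorted (fun i j : 'I_n => (i < j)%N) s)
    (eta : 'S_n.*2)
    (heta : eta = perm_comp (star theta) (\big[@perm_comp n.*2/1%g]_(i <- s) rho i)) :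
  digraph_iso_onto (G R theta) (G R eta) (W1 n) (@vtx_even n)
  /\ (forall i j : 'I_n.-1,
        adjacency (G R eta) (vtx_even i) (vtx_even j)
        = adjacency (G R theta) i j).
Proof.
have edges : forall i j, G R eta (vtx_even i) (vtx_even j) = G R theta i j.
  by apply: G_vtx_even => x; rewrite heta pt_half_star_rho.
split; first by split; [exact: vtx_even_inj | exact: vtx_even_image |].
by move=> i j; rewrite !mxE edges.
Qed.
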